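(* Let $\mathcal{G}$ be a finite collection of nonempty subsets of $\{1,\dots,d\}$, let $n=\sum_{g\in\mathcal{G}}|g|$, and let $\mathbb{R}^n$ be partitioned into pairwise disjoint index blocks $j(g)$, $|j(g)|=|g|$, $g\in\mathcal{G}$, with $\mathbf{x}_{j(g)}$ identified with a vector supported on the coordinates in $g$. Let $M\in\{0,1\}^{d\times n}$ satisfy $(M\mathbf{x})_i=\sum_{g\in\mathcal{G}:\,i\in g}(\text{entry of }\mathbf{x}_{j(g)}\text{ corresponding to }i)$. Let $\lambda>0$, $w_g>0$, $\mathbf{b}\in\mathbb{R}^d$, $\rho>0$, and consider the problem $$\min_{\mathbf{x}^1,\mathbf{x}^2\in\mathbb{R}^n}\ \lambda\sum_{g\in\mathcal{G}}w_g\|\mathbf{x}^1_{j(g)}\|_2+\tfrac12\|M\mathbf{x}^2-\mathbf{b}\|_2^2\quad\text{s.t.}\quad\mathbf{x}^1=\mathbf{x}^2 .$$ Consider the ADMM iteration with dual stepsize $\alpha>0$: $$\mathbf{x}^{1,k+1}_{j(g)}=\arg\min_{\mathbf{z}\in\mathbb{R}^{|g|}}\lambda w_g\|\mathbf{z}\|_2+\tfrac{\rho}{2}\big\|\mathbf{z}-\mathbf{x}^{2,k}_{j(g)}+\tfrac1\rho\mathbf{y}^k_{j(g)}\big\|_2^2\quad(g\in\mathcal{G}),$$ $$\mathbf{x}^{2,k+1}=\arg\min_{\mathbf{x}^2\in\mathbb{R}^n}\tfrac12\|M\mathbf{x}^2-\mathbf{b}\|_2^2+\tfrac{\rho}{2}\big\|\mathbf{x}^2-\mathbf{x}^{1,k+1}-\tfrac1\rho\mathbf{y}^k\big\|_2^2,$$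 $$\mathbf{y}^{k+1}=\mathbf{y}^k+\alpha(\mathbf{x}^{1,k+1}-\mathbf{x}^{2,k+1}).$$ Then, provided the stepsize $\alpha$ is sufficiently small, the sequence $\{(\mathbf{x}^{1,k},\mathbf{x}^{2,k},\mathbf{y}^k)\}$ generated by this algorithm converges linearly to a primal-dual optimal solution of the problem.
   Context: The problem is a reformulation of evaluating the proximal operator of the latent overlapping group lasso penalty $\lambda\Omega(\boldsymbol\beta)$, $\Omega(\boldsymbol\beta)=\inf\{\sum_g w_g\|\boldsymbol\nu^{(g)}\|_2:\sum_g\boldsymbol\nu^{(g)}=\boldsymbol\beta,\ \boldsymbol\nu^{(g)}_{g^c}=0\}$, at $\mathbf{b}$; its objective is not strongly convex. A primal-dual optimal solution is a pair consisting of a minimizer $(\mathbf{x}^{1,*},\mathbf{x}^{2,*})$ of the problem and a maximizer $\mathbf{y}^*$ of the augmented dual function $g_\rho(\mathbf{y})=\min_{\mathbf{x}^1,\mathbf{x}^2}\big[\lambda\sum_g w_g\|\mathbf{x}^1_{j(g)}\|_2+\frac12\|M\mathbf{x}^2-\mathbf{b}\|_2^2+\langle\mathbf{y},\mathbf{x}^1-\mathbf{x}^2\rangle+\frac\rho2\|\mathbf{x}^1-\mathbf{x}^2\|_2^2\big]$. *)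

(* Defs.v *)
From HB Require Import structures.
From mathcomp Require Import all_boot all_order all_algebra.
From mathcomp Require Import classical_sets reals.
Set Implicit Arguments. Unset Strict Implicit. Unset Printing Implicit Defensive.
Import Order.TTheory GRing.Theory Num.Theory.
Local Open Scope ring_scope.

Section LOGL.
Variables (R : realType) (d n : nat).

(* Coordinate labelling of R^n: coordinate k of x lies in block j(g) with
   g = (c k).1 and corresponds to the coordinate i = (c k).2 of {1..d}. *)
Variable c : 'I_n -> {set 'I_d} * 'I_d.

Definition sqn m (x : 'cV[R]_m) : R := \sum_(k < m) x k 0 ^+ 2.
Definition dotv m (x z : 'cV[R]_m) : R := \sum_(k < m) x k 0 * z k 0.

Definition bsq (g : {set 'I_d}) (x : 'cV[R]_n) : R :=
  \sum_(k < n | (c k).1 == g) x k 0 ^+ 2.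
Definition bnorm g x : R := Num.sqrt (bsq g x).

(* The 0/1 matrix M: (M x)_i = sum over g containing i of the entry of
   x_{j(g)} corresponding to i. *)
Definition Mmx : 'M[R]_(d, n) := \matrix_(i < d, k < n) ((c k).2 == i)%:R.

Variables (G : {set {set 'I_d}}) (w : {set 'I_d} -> R) (lam rho : R)
  (b : 'cV[R]_d).

Definition penalty (x : 'cV[R]_n) : R := lam * \sum_(g in G) w g * bnorm g x.
Definition loss (x : 'cV[R]_n) : R := 2^-1 * sqn (Mmx *m x - b).

Definition objective x1 x2 : R := penalty x1 + loss x2.

Definition aug_lag x1 x2 (y : 'cV[R]_n) : R :=
  objective x1 x2 + dotv y (x1 - x2) + rho / 2 * sqn (x1 - x2).
Definition aug_dual (y : 'cV[R]_n) : R :=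
  inf (range (fun p : 'cV[R]_n * 'cV[R]_n => aug_lag p.1 p.2 y)).

Definition primal_opt (x1 x2 : 'cV[R]_n) : Prop :=
  x1 = x2 /\ forall z1 z2, z1 = z2 -> objective x1 x2 <= objective z1 z2.
Definition dual_opt (y : 'cV[R]_n) : Prop := forall z, aug_dual z <= aug_dual y.
Definition primal_dual_opt x1 x2 y : Prop := primal_opt x1 x2 /\ dual_opt y.

Definition admm_seq (alpha : R) (x1 x2 y : nat -> 'cV[R]_n) : Prop :=
  forall k : nat,
    (forall g, g \in G -> forall z : 'cV[R]_n,
        lam * w g * bnorm g (x1 k.+1)
          + rho / 2 * bsq g (x1 k.+1 - x2 k + rho^-1 *: y k)
        <= lam * w g * bnorm g z + rho / 2 * bsq g (z - x2 k + rho^-1 *: y k))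
    /\ (forall z : 'cV[R]_n,
        2^-1 * sqn (Mmx *m x2 k.+1 - b) + rho / 2 * sqn (x2 k.+1 - x1 k.+1 - rho^-1 *: y k)
        <= 2^-1 * sqn (Mmx *m z - b) + rho / 2 * sqn (z - x1 k.+1 - rho^-1 *: y k))
    /\ y k.+1 = y k + alpha *: (x1 k.+1 - x2 k.+1).

Definition dist3 (x1 x2 y z1 z2 v : 'cV[R]_n) : R :=
  Num.sqrt (sqn (x1 - z1) + sqn (x2 - z2) + sqn (y - v)).

End LOGL.

(* Main.v *)
Require Import Defs.
From HB Require Import structures.
From mathcomp Require Import boolp classical_sets reals topology normedtype.
From mathcomp Require Import sequences realfun derive.
From mathcomp Require Import all_boot all_order all_algebra.
From mathcomp Require Import ring lra.
Set Implicit Arguments. Unset Strict Implicit. Unset Printing Implicit Defensive.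
Import Order.TTheory GRing.Theory Num.Theory.
Import numFieldNormedType.Exports.
Local Open Scope ring_scope.

(* The pair (x, y) is optimal iff y = M^T (M x - b) and -y is a subgradient of
   the penalty at x.  All solutions share the same y* and the same image M x, so
   the solution set S is a polyhedron: a block x_g vanishes when
   |y*_g| < lam w_g and is a nonpositive multiple of y*_g otherwise.

   For alpha <= rho / 2 and every z in S the function
   V_k(z) = |y^k - y*|^2 / alpha + rho |x2^k - z|^2 decreases at each step by at
   least (rho / 8) (|r|^2 + |delta|^2), where r = x1 - x2 is the new primal
   residual and delta the increment of x2.  Hence the iterates stay bounded, and
   on a bounded set Hoffman's bound for S, together with the calmness of the
   subdifferential of the group norms, gives
   dist(x1, S) <= K (|M x1 - M x*| + |u - y*|), where -u is the subgradient
   certified by the x1-step.  Inserting the nearest z into the monotonicity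
   inequalities bounds |M x2 - M x*|, and then dist(x2, S) and |y - y*|, by a
   multiple of |r| + |delta|.  So inf_{S} V_k decays geometrically, the
   increments are summable, and the limit lies in the closed set S. *)

(** * Hoffman's error bound *)

(** The maximum of [s - eta] and all lower bounds works; starting from [s - eta] also covers the
    case without lower bounds. *)
Lemma interval_clamp (R : realFieldType) (J : finType) (P Q : pred J)
    (L U : J -> R) (s eta : R) :
  0 <= eta ->
  (forall l j, P l -> Q j -> L l <= U j) ->
  (forall l, P l -> L l <= s + eta) ->
  (forall j, Q j -> s <= U j + eta) ->
  exists s', [/\ forall l, P l -> L l <= s', forall j, Q j -> s' <= U j
    & `|s - s'| <= eta].
Proof.
move=> eta0 LU Ls sU.
exists (\big[Num.max/s - eta]_(l | P l) L l); split.
- by move=> l Pl; apply: le_bigmax_cond.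
- move=> j Qj; apply/bigmax_leP; split; last by move=> l Pl; apply: LU.
  by rewrite lerBlDr sU.
- rewrite distrC ler_distl; apply/andP; split; first exact: bigmax_ge_id.
  apply/bigmax_leP; split; last exact: Ls.
  by rewrite lerD2l ge0_cp.
Qed.

(* Hoffman's bound by Fourier-Motzkin elimination: the violation of the
   eliminated system is controlled by that of the original one, and once the
   other variables are feasible for it the first one is clamped to a nonempty
   interval. *)
Lemma hoffman_bound (R : realFieldType) (n : nat) (J : finType)
    (a : J -> 'I_n -> R) (e : J -> R) :
  (exists x : 'I_n -> R, forall j, \sum_i a j i * x i <= e j) ->
  exists2 K, 0 <= K & forall (x : 'I_n -> R) (eps : R), 0 <= eps ->
    (forall j, \sum_i a j i * x i <= e j + eps) ->
    exists x' : 'I_n -> R, (forall j, \sum_i a j i * x' i <= e j)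
      /\ forall i, `|x i - x' i| <= K * eps.
Proof.
elim: n J a e => [|n IH] J a e [x0 hx0].
  exists 0 => // x eps _ _; exists x; split; last by case.
  by move=> j; have := hx0 j; rewrite !big_ord0.
pose p j := a j ord0.
pose a' j i := a j (lift ord0 i).
pose pair (q : J * J) := (0 < p q.1) && (p q.2 < 0).
(* Rows free of the first variable are kept, and each pair with coefficients of opposite sign is
   combined to cancel it. All other indices carry the trivial row [0 <= 0]. *)
pose A (q : J + J * J) i := match q with
  | inl j => if p j == 0 then a' j i else 0
  | inr q => if pair q then (p q.1)^-1 * a' q.1 i - (p q.2)^-1 * a' q.2 i else 0
  end.
pose E (q : J + J * J) := match q with
  | inl j => if p j == 0 then e j else 0
  | inr q => if pair q then (p q.1)^-1 * e q.1 - (p q.2)^-1 * e q.2 else 0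
  end.
(* A common bound for the scaling factors, so a combined row is violated by at most [2 * c * eps];
   the [1] in [1 + 2 * c] serves the unscaled rows. *)
pose c := \sum_j `|p j|^-1.
have c0 : 0 <= c by apply: sumr_ge0 => j _; rewrite invr_ge0.
have pc j : `|p j|^-1 <= c.
  by rewrite /c (bigD1 j) //= lerDl; apply: sumr_ge0 => l _; rewrite invr_ge0.
have split_sum (j : J) (x : 'I_n.+1 -> R) :
    \sum_i a j i * x i = p j * x ord0 + \sum_i a' j i * x (lift ord0 i).
  by rewrite big_ord_recl.
have A_sum (q : J * J) (t : 'I_n -> R) : pair q -> \sum_i A (inr q) i * t i =
    (p q.1)^-1 * (\sum_i a' q.1 i * t i) - (p q.2)^-1 * (\sum_i a' q.2 i * t i).
  move=> hq; rewrite !mulr_sumr -sumrB; apply: eq_bigr => i _ /=; rewrite hq.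
  by ring.
have elim_viol (x : 'I_n.+1 -> R) (eps : R) : 0 <= eps ->
    (forall j, \sum_i a j i * x i <= e j + eps) ->
    forall q, \sum_i A q i * x (lift ord0 i) <= E q + (1 + 2 * c) * eps.
  move=> eps0 hx [j|q].
    rewrite /=; case: eqP => [pj0|_].
      have := hx j; rewrite split_sum pj0 mul0r add0r => h; apply: (le_trans h).
      by rewrite lerD2l mulrDl mul1r lerDl !mulr_ge0.
    rewrite big1 ?add0r => [|i _]; last by rewrite mul0r.
    by rewrite mulr_ge0 // addr_ge0 // mulr_ge0.
  rewrite [E _]/=; case: ifP => hq; last first.
    rewrite /= big1 ?add0r => [|i _]; last by rewrite hq mul0r.
    by rewrite mulr_ge0 // addr_ge0 // mulr_ge0.
  rewrite A_sum //; case/andP: hq; case: q => j l /= pj pl.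
  have := hx j; have := hx l; rewrite !split_sum => hl hj.
  have cj := pc j; have cl := pc l.
  have gj : 0 < (p j)^-1 by rewrite invr_gt0.
  have gl : 0 < - (p l)^-1 by rewrite oppr_gt0 invr_lt0.
  rewrite (gtr0_norm pj) in cj; rewrite (ltr0_norm pl) invrN in cl.
  have := ler_wpM2l (ltW gj) hj; have := ler_wpM2l (ltW gl) hl.
  rewrite !mulrDr !mulrA mulNr (mulVf (lt0r_neq0 pj)) (mulVf (ltr0_neq0 pl)).
  move=> {}hl {}hj.
  have := ler_wpM2r eps0 cj; have := ler_wpM2r eps0 cl.
  by nra.
have [|K K0 hK] := IH _ A E.
  exists (fun i => x0 (lift ord0 i)) => q.
  have := elim_viol x0 0 (lexx _) _ q; rewrite mulr0 addr0; apply => j.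
  by rewrite addr0.
pose B := \sum_j \sum_i `|a' j i|.
have B0 : 0 <= B by apply: sumr_ge0 => j _; apply: sumr_ge0.
(* [K1] bounds the shift of the remaining variables. That shift raises each row's violation to
   [(1 + B * K1) * eps], and dividing by [p j] costs the factor [c] in [K2]. *)
pose K1 := K * (1 + 2 * c); pose K2 := c * (1 + B * K1).
have K10 : 0 <= K1 by rewrite mulr_ge0 // addr_ge0 // mulr_ge0.
have K20 : 0 <= K2 by rewrite mulr_ge0 // addr_ge0 // mulr_ge0.
exists (K1 + K2) => [|x eps eps0 hx]; first exact: addr_ge0.
have [|t [ht tx]] := hK (fun i => x (lift ord0 i)) _ _ (elim_viol _ _ eps0 hx).
  by rewrite mulr_ge0 // addr_ge0 // mulr_ge0.
pose T j := \sum_i a' j i * t i.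
have viol j : p j * x ord0 + T j <= e j + (1 + B * K1) * eps.
  have := hx j; rewrite split_sum => hj.
  suff : T j - \sum_i a' j i * x (lift ord0 i) <= B * K1 * eps by lra.
  rewrite /T -sumrB (le_trans (ler_norm _)) // (le_trans (ler_norm_sum _ _ _)) //.
  rewrite -mulrA /B (bigD1 j) //= mulrDl ler_wpDr //.
    by apply: mulr_ge0; [do 2![apply: sumr_ge0 => ? _] | exact: mulr_ge0].
  rewrite mulr_suml; apply: ler_sum => i _.
  by rewrite -mulrBr normrM ler_wpM2l // distrC /K1 -mulrA tx.
have e2 : 0 <= (1 + B * K1) * eps by rewrite mulr_ge0 // addr_ge0 // mulr_ge0.
have K2e : K2 * eps = c * ((1 + B * K1) * eps) by rewrite mulrA.
set X := (1 + B * K1) * eps in viol e2 K2e; clearbody X.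
have [||||s [hL hU hs]] := @interval_clamp _ J [pred l | p l < 0]
    [pred j | 0 < p j] (fun l => (p l)^-1 * (e l - T l))
    (fun j => (p j)^-1 * (e j - T j)) (x ord0) (K2 * eps).
- exact: mulr_ge0.
- move=> l j /= pl pj; have hq : pair (j, l) by rewrite /pair /= pj pl.
  by have := ht (inr (j, l)); rewrite A_sum //= hq /T; lra.
- move=> l /= pl; have cl := pc l.
  have gl : 0 < - (p l)^-1 by rewrite oppr_gt0 invr_lt0.
  rewrite (ltr0_norm pl) invrN in cl.
  have := ler_wpM2l (ltW gl) (viol l).
  rewrite !mulrDr !mulrA mulNr (mulVf (ltr0_neq0 pl)).
  have := ler_wpM2r e2 cl; rewrite K2e; lra.
- move=> j /= pj; have cj := pc j.
  have gj : 0 < (p j)^-1 by rewrite invr_gt0.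
  rewrite (gtr0_norm pj) in cj.
  have := ler_wpM2l (ltW gj) (viol j).
  rewrite !mulrDr !mulrA (mulVf (lt0r_neq0 pj)).
  have := ler_wpM2r e2 cj; rewrite K2e; lra.
exists (fun i => if unlift ord0 i is Some i' then t i' else s); split.
- move=> j; rewrite split_sum unlift_none.
  under eq_bigr do rewrite liftK.
  rewrite -/(T j); have [pj|pj|pj] := ltrgtP (p j) 0.
  + have := hL j pj; rewrite -(ler_nM2l pj) mulrA divff ?lt_eqF //; lra.
  + have := hU j pj; rewrite -(ler_pM2l pj) mulrA divff ?gt_eqF //; lra.
  + by have := ht (inl j); rewrite /= pj eqxx mul0r add0r.
- move=> i; case: unliftP => [i' ->|->].
    by rewrite (le_trans (tx i')) // mulrA ler_wpM2r // lerDl.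
  by rewrite (le_trans hs) // ler_wpM2r // lerDr.
Qed.

(** * Euclidean norms and blocks *)

(** Serves to extract first-order conditions from minimality along a segment. If [a < 0], the chosen
    [s] satisfies [a + s * |k| = s * a < 0], a contradiction. *)
Lemma ge0_of_small_quadratic (R : realFieldType) (a k : R) :
  (forall s, 0 < s -> s <= 1 -> 0 <= s * a + s ^+ 2 * k) -> 0 <= a.
Proof.
move=> h; rewrite leNgt; apply/negP => a0.
have d0 : 0 < `|k| - a by have := normr_ge0 k; lra.
pose s := - a / (`|k| - a).
have sd : s * (`|k| - a) = - a by rewrite /s divfK ?gt_eqF.
have s0 : 0 < s by rewrite divr_gt0 // oppr_gt0.
have s1 : s <= 1 by rewrite ler_pdivrMr // mul1r lerDr.
have := h _ s0 s1; rewrite expr2 -mulrA -mulrDr pmulr_rge0 //.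
have := ler_wpM2l (ltW s0) (ler_norm k).
have : s * a < 0 by rewrite pmulr_rlt0.
by lra.
Qed.

(** * Cauchy-Schwarz and Minkowski over a filtered index set *)

Section FiniteSums.
Variables (R : realType) (I : finType) (P : pred I).
Implicit Types f g : I -> R.

Lemma sum_sqr_ge0 f : 0 <= \sum_(i | P i) f i ^+ 2.
Proof. by apply: sumr_ge0 => i _; apply: sqr_ge0. Qed.

Lemma cauchy_schwarz f g : (\sum_(i | P i) f i * g i) ^+ 2 <=
  (\sum_(i | P i) f i ^+ 2) * (\sum_(i | P i) g i ^+ 2).
Proof.
set A := \sum_(i | P i) f i ^+ 2; set B := \sum_(i | P i) g i ^+ 2.
set C := \sum_(i | P i) f i * g i.
have [B0|B0] := eqVneq B 0.
  have g0 i : P i -> g i = 0.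
    move=> Pi; apply/eqP; rewrite -sqrf_eq0; move/eqP: B0.
    rewrite psumr_eq0; last by move=> ? _; apply: sqr_ge0.
    by move/allP/(_ i (mem_index_enum _)); rewrite Pi.
  by rewrite B0 mulr0 /C big1 ?expr0n // => i Pi; rewrite g0 ?mulr0.
have {}B0 : 0 < B by rewrite lt_def B0 sum_sqr_ge0.
rewrite -subr_ge0 -(pmulr_rge0 _ B0).
have -> : B * (A * B - C ^+ 2) = \sum_(i | P i) (B * f i - C * g i) ^+ 2.
  under eq_bigr do rewrite sqrrB !exprMn.
  rewrite big_split sumrB /= -!mulr_sumr -/A -/B.
  have -> : \sum_(i | P i) B * f i * (C * g i) *+ 2 = 2 * B * C * C.
    by rewrite /C mulr_sumr; apply: eq_bigr => i _; ring.
  by ring.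
exact: sum_sqr_ge0.
Qed.

Lemma cauchy_schwarz_sqrt f g : `|\sum_(i | P i) f i * g i| <=
  Num.sqrt (\sum_(i | P i) f i ^+ 2) * Num.sqrt (\sum_(i | P i) g i ^+ 2).
Proof.
rewrite -sqrtr_sqr -sqrtrM ?sum_sqr_ge0 //.
by rewrite ler_sqrt ?cauchy_schwarz // mulr_ge0 ?sum_sqr_ge0.
Qed.

Lemma sqrt_sum_sqrD f g : Num.sqrt (\sum_(i | P i) (f i + g i) ^+ 2) <=
  Num.sqrt (\sum_(i | P i) f i ^+ 2) + Num.sqrt (\sum_(i | P i) g i ^+ 2).
Proof.
rewrite -[leRHS]ger0_norm ?addr_ge0 ?sqrtr_ge0 //.
rewrite -sqrtr_sqr ler_sqrt ?sqr_ge0 // sqrrD !sqr_sqrtr ?sum_sqr_ge0 //.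
under eq_bigr do rewrite sqrrD mulr2n.
rewrite !big_split /= lerD2r lerD2l mulr2n.
by apply: lerD; apply: le_trans (ler_norm _) (cauchy_schwarz_sqrt _ _).
Qed.

Lemma sqrt_sum_sqrZ a f : Num.sqrt (\sum_(i | P i) (a * f i) ^+ 2) =
  `|a| * Num.sqrt (\sum_(i | P i) f i ^+ 2).
Proof.
under eq_bigr do rewrite exprMn.
by rewrite -mulr_sumr sqrtrM ?sqr_ge0 // sqrtr_sqr.
Qed.

Lemma norm_le_sqrt_sum_sqr f i : P i ->
  `|f i| <= Num.sqrt (\sum_(i | P i) f i ^+ 2).
Proof.
move=> Pi; rewrite -sqrtr_sqr ler_sqrt ?sum_sqr_ge0 // (bigD1 i) //= lerDl.
by apply: sumr_ge0 => j _; apply: sqr_ge0.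
Qed.

End FiniteSums.

Section Euclidean.
Variable R : realType.

Section Fixed.
Variable m : nat.
Implicit Types x y z : 'cV[R]_m.

Definition nrm x : R := Num.sqrt (sqn x).

Lemma sqn_ge0 x : 0 <= sqn x. Proof. exact: sum_sqr_ge0. Qed.
Lemma nrm_ge0 x : 0 <= nrm x. Proof. exact: sqrtr_ge0. Qed.
Lemma sqr_nrm x : nrm x ^+ 2 = sqn x. Proof. by rewrite sqr_sqrtr ?sqn_ge0. Qed.

Lemma dotvC x y : dotv x y = dotv y x.
Proof. by apply: eq_bigr => i _; rewrite mulrC. Qed.

Lemma dotvDl x y z : dotv (x + y) z = dotv x z + dotv y z.
Proof. by rewrite -big_split; apply: eq_bigr => i _; rewrite /= mxE mulrDl. Qed.

Lemma dotvZl a x z : dotv (a *: x) z = a * dotv x z.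
Proof. by rewrite mulr_sumr; apply: eq_bigr => i _; rewrite mxE mulrA. Qed.

Lemma dotvNl x z : dotv (- x) z = - dotv x z.
Proof. by rewrite -scaleN1r dotvZl mulN1r. Qed.

Lemma dotvDr x y z : dotv z (x + y) = dotv z x + dotv z y.
Proof. by rewrite dotvC dotvDl !(dotvC z). Qed.

Lemma dotvZr a x z : dotv z (a *: x) = a * dotv z x.
Proof. by rewrite dotvC dotvZl (dotvC z). Qed.

Lemma dotvNr x z : dotv z (- x) = - dotv z x.
Proof. by rewrite dotvC dotvNl (dotvC z). Qed.

Definition dotvE := (dotvDl, dotvNl, dotvZl, dotvDr, dotvNr, dotvZr).

Lemma sqnE x : sqn x = dotv x x.
Proof. by apply: eq_bigr => i _; rewrite expr2. Qed.

Lemma sqn_eq0 x : (sqn x == 0) = (x == 0).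
Proof.
apply/eqP/eqP => [/eqP|->]; last by rewrite /sqn big1 // => i _; rewrite mxE expr0n.
rewrite psumr_eq0; last by move=> ? _; apply: sqr_ge0.
move/allP => h; apply/colP => i; have := h i (mem_index_enum _).
by rewrite sqrf_eq0 mxE => /eqP.
Qed.

Lemma sqnN x : sqn (- x) = sqn x.
Proof. by rewrite !sqnE !dotvE opprK. Qed.

Lemma nrmN x : nrm (- x) = nrm x. Proof. by rewrite /nrm sqnN. Qed.

Lemma nrmB x y : nrm (x - y) = nrm (y - x).
Proof. by rewrite -nrmN opprB. Qed.

Lemma nrmD x y : nrm (x + y) <= nrm x + nrm y.
Proof.
rewrite /nrm /sqn; under eq_bigr do rewrite mxE.
exact: sqrt_sum_sqrD.
Qed.

Lemma nrmZ a x : nrm (a *: x) = `|a| * nrm x.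
Proof.
rewrite /nrm /sqn; under eq_bigr do rewrite mxE.
exact: sqrt_sum_sqrZ.
Qed.

Lemma dotv_le x y : dotv x y <= nrm x * nrm y.
Proof. exact: le_trans (ler_norm _) (cauchy_schwarz_sqrt _ _ _). Qed.

Lemma coord_le_nrm x i : `|x i 0| <= nrm x.
Proof. exact: (norm_le_sqrt_sum_sqr (fun i => x i 0)). Qed.

Lemma nrm_le_sum x : nrm x <= \sum_i `|x i 0|.
Proof.
have S0 : 0 <= \sum_i `|x i 0| by apply: sumr_ge0.
rewrite -(ger0_norm S0) -sqrtr_sqr ler_sqrt ?sqr_ge0 // expr2 mulr_suml.
apply: ler_sum => i _; rewrite -real_normK ?num_real // expr2 ler_wpM2l //.
by rewrite (bigD1 i) //= lerDl sumr_ge0.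
Qed.

Lemma nrm_le_coord x e : (forall i, `|x i 0| <= e) -> nrm x <= m%:R * e.
Proof.
move=> h; apply: (le_trans (nrm_le_sum x)).
have -> : m%:R * e = \sum_(i < m) e by rewrite sumr_const card_ord mulr_natl.
exact: ler_sum.
Qed.

End Fixed.

Lemma dotv_mulmx m p (A : 'M[R]_(m, p)) x y :
  dotv (A *m x) y = dotv x (A^T *m y).
Proof.
rewrite /dotv; under eq_bigr do rewrite mxE mulr_suml.
rewrite exchange_big /=; apply: eq_bigr => j _; rewrite mxE mulr_sumr.
by apply: eq_bigr => i _; rewrite mxE; ring.
Qed.

Lemma nrm_mulmx_le m p (A : 'M[R]_(m, p)) :
  exists2 K, 0 <= K & forall x, nrm (A *m x) <= K * nrm x.
Proof.
exists (\sum_i \sum_j `|A i j|) => [|x].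
  by apply: sumr_ge0 => i _; apply: sumr_ge0.
apply: (le_trans (nrm_le_sum _)); rewrite mulr_suml; apply: ler_sum => i _.
rewrite mxE (le_trans (ler_norm_sum _ _ _)) // mulr_suml.
by apply: ler_sum => j _; rewrite normrM ler_wpM2l // coord_le_nrm.
Qed.

End Euclidean.

(** * Block seminorms and their subgradients *)

Section Blocks.
Variables (R : realType) (d n : nat) (c : 'I_n -> {set 'I_d} * 'I_d).
Variable g : {set 'I_d}.
Implicit Types x y z u : 'cV[R]_n.

Definition bdot u x : R := \sum_(k < n | (c k).1 == g) u k 0 * x k 0.

Local Notation bsq := (bsq c g).
Local Notation bnorm := (bnorm c g).

Lemma bsq_ge0 x : 0 <= bsq x. Proof. exact: sum_sqr_ge0. Qed.
Lemma bnorm_ge0 x : 0 <= bnorm x. Proof. exact: sqrtr_ge0. Qed.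
Lemma sqr_bnorm x : bnorm x ^+ 2 = bsq x.
Proof. by rewrite sqr_sqrtr ?bsq_ge0. Qed.

Lemma bdotC x y : bdot x y = bdot y x.
Proof. by apply: eq_bigr => i _; rewrite mulrC. Qed.

Lemma bdotDl x y z : bdot (x + y) z = bdot x z + bdot y z.
Proof. by rewrite -big_split; apply: eq_bigr => i _; rewrite /= mxE mulrDl. Qed.

Lemma bdotZl a x z : bdot (a *: x) z = a * bdot x z.
Proof. by rewrite mulr_sumr; apply: eq_bigr => i _; rewrite mxE mulrA. Qed.

Lemma bdotNl x z : bdot (- x) z = - bdot x z.
Proof. by rewrite -scaleN1r bdotZl mulN1r. Qed.

Lemma bdotDr x y z : bdot z (x + y) = bdot z x + bdot z y.
Proof. by rewrite bdotC bdotDl !(bdotC z). Qed.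

Lemma bdotZr a x z : bdot z (a *: x) = a * bdot z x.
Proof. by rewrite bdotC bdotZl (bdotC z). Qed.

Lemma bdotNr x z : bdot z (- x) = - bdot z x.
Proof. by rewrite bdotC bdotNl (bdotC z). Qed.

Definition bdotE := (bdotDl, bdotNl, bdotZl, bdotDr, bdotNr, bdotZr).

Lemma bsqE x : bsq x = bdot x x.
Proof. by apply: eq_bigr => i _; rewrite expr2. Qed.

Lemma bnormD x y : bnorm (x + y) <= bnorm x + bnorm y.
Proof.
rewrite /Defs.bnorm /Defs.bsq; under eq_bigr do rewrite mxE.
exact: sqrt_sum_sqrD.
Qed.

Lemma bnormZ a x : bnorm (a *: x) = `|a| * bnorm x.
Proof.
rewrite /Defs.bnorm /Defs.bsq; under eq_bigr do rewrite mxE.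
exact: sqrt_sum_sqrZ.
Qed.

Lemma bnorm0 : bnorm (0 : 'cV[R]_n) = 0.
Proof. by rewrite -(scale0r (0 : 'cV[R]_n)) bnormZ normr0 mul0r. Qed.

Lemma bdot_norm_le x y : `|bdot x y| <= bnorm x * bnorm y.
Proof. exact: cauchy_schwarz_sqrt. Qed.

Lemma bnorm_convex s x z : 0 <= s -> s <= 1 ->
  bnorm (x + s *: (z - x)) <= (1 - s) * bnorm x + s * bnorm z.
Proof.
move=> s0 s1; have -> : x + s *: (z - x) = (1 - s) *: x + s *: z.
  by apply/colP => i; rewrite !mxE; ring.
by rewrite (le_trans (bnormD _ _)) // !bnormZ !ger0_norm // subr_ge0.
Qed.

Lemma bnorm_le_nrm x : bnorm x <= nrm x.
Proof.
rewrite ler_sqrt ?sqn_ge0 // /sqn [leRHS](bigID (fun k => (c k).1 == g)) /= lerDl.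
exact: sum_sqr_ge0.
Qed.

Lemma coord_le_bnorm x k : (c k).1 = g -> `|x k 0| <= bnorm x.
Proof.
move=> /eqP kg.
exact: (@norm_le_sqrt_sum_sqr _ _ (fun k => (c k).1 == g) (fun k => x k 0)).
Qed.

(* [bsubgrad tau u x]: on block [g], [- u] is a subgradient of [tau * |.|]
   at [x], in the form given by the equality case of Cauchy-Schwarz. *)
Definition bsubgrad (tau : R) u x :=
  bnorm u <= tau /\ bdot u x = - (tau * bnorm x).

Lemma bsubgrad_ineq tau u x z : bsubgrad tau u x ->
  tau * bnorm x <= tau * bnorm z + bdot u (z - x).
Proof.
move=> [ut ux]; rewrite !bdotE ux.
have := bdot_norm_le u z; rewrite ler_norml => /andP[h _].
have := ler_wpM2r (bnorm_ge0 z) ut; lra.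
Qed.

(** The test points [0] and [2 *: x] force the equality for [bdot u x]; the test point [- u] then
    gives [|u|^2 <= tau * |u|]. *)
Lemma bsubgradP tau u x : 0 <= tau ->
  (forall z, tau * bnorm x <= tau * bnorm z + bdot u (z - x)) ->
  bsubgrad tau u x.
Proof.
move=> tau0 h; have := h 0; have := h (2 *: x); have := h (- u + x).
rewrite addrK sub0r !bdotE bnormZ bnorm0 mulr0 add0r ger0_norm // -bsqE => h1 h2 h3.
have ux : bdot u x = - (tau * bnorm x) by lra.
split=> //; have := h (- u); rewrite !bdotE ux -bsqE -sqr_bnorm.
rewrite -scaleN1r bnormZ normrN1 mul1r => h4.
have [u0|u0] := eqVneq (bnorm u) 0; first by rewrite u0.
have {}u0 : 0 < bnorm u by rewrite lt_def u0 bnorm_ge0.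
rewrite -(ler_pM2r u0); lra.
Qed.

Lemma bsubgrad_mono tau u x u' x' : bsubgrad tau u x -> bsubgrad tau u' x' ->
  bdot (u - u') (x - x') <= 0.
Proof.
move=> h h'; have := bsubgrad_ineq x' h; have := bsubgrad_ineq x h'.
rewrite !bdotE; lra.
Qed.

(** Minimality is tested at [x + s *: (z - x)]: convexity handles the norm, and the terms of first
    order in [s] form the subgradient inequality. *)
Lemma bprox_subgrad tau rho u x p : 0 <= tau ->
  u = rho *: (x + p) ->
  (forall z, tau * bnorm x + rho / 2 * bsq (x + p)
             <= tau * bnorm z + rho / 2 * bsq (z + p)) ->
  bsubgrad tau u x.
Proof.
move=> tau0 -> h; apply: bsubgradP => // z.
rewrite -subr_ge0.
apply: (@ge0_of_small_quadratic _ _ (rho / 2 * bsq (z - x))) => s s0 s1.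
have := h (x + s *: (z - x)); have := bnorm_convex x z (ltW s0) s1.
move=> /(ler_wpM2l tau0).
have -> : x + s *: (z - x) + p = (x + p) + s *: (z - x) by rewrite addrAC.
move: (z - x) => t; rewrite !bsqE; move: (x + p) => q; rewrite !bdotE (bdotC t q).
set A := bdot q t; set B := bdot t t; set C := bdot q q; rewrite expr2.
by lra.
Qed.

(** Equality case of Cauchy-Schwarz: on the block, [|tau x + |x| u|^2 = |x|^2 (|u|^2 - tau^2) <=
    0]. *)
Lemma bsubgrad_coord (tau : R) u x k : 0 <= tau -> bsubgrad tau u x ->
  (c k).1 = g -> tau * x k 0 = - (bnorm x * u k 0).
Proof.
move=> tau0 [ut ux] kg.
suff /eqP : bsq (tau *: x + bnorm x *: u) == 0.
  rewrite /Defs.bsq => /eqP; rewrite psumr_eq0 => [/allP h|i _]; last exact: sqr_ge0.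
  have := h k (mem_index_enum _); rewrite kg eqxx /= sqrf_eq0 !mxE => /eqP; lra.
rewrite eq_le bsq_ge0 andbT bsqE !bdotE -!bsqE (bdotC x u) ux -!sqr_bnorm.
have x0 := bnorm_ge0 x; have u0 := bnorm_ge0 u.
have := ler_wpM2l x0 (ler_wpM2l x0 (ler_pM u0 u0 ut ut)).
set X := bnorm x; set U := bnorm u; nra.
Qed.

(** Complementary slackness: a block with [|u| < tau] must vanish. *)
Lemma bsubgrad_slack (tau : R) u x : bsubgrad tau u x ->
  (tau - bnorm u) * bnorm x <= 0.
Proof.
move=> [ut ux]; have := bdot_norm_le u x; rewrite ler_norml ux => /andP[h _].
lra.
Qed.

End Blocks.

(** * Optimality conditions *)

Lemma sum_continuous (R : realType) (T : topologicalType) (I : Type)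
    (r : seq I) (P : pred I) (F : I -> T -> R) :
  (forall i, P i -> continuous (F i)) ->
  continuous (fun t => \sum_(i <- r | P i) F i t).
Proof.
move=> hF; elim: r => [|i r IH].
  have -> : (fun t => \sum_(i <- [::] | P i) F i t) = fun=> 0.
    by apply/funext => u; rewrite big_nil.
  by move=> t; apply: cst_continuous.
case: (boolP (P i)) => Pi; last first.
  have -> // : (fun t => \sum_(i <- i :: r | P i) F i t) =
    fun t => \sum_(i <- r | P i) F i t.
  by apply/funext => u; rewrite big_cons (negPf Pi).
have -> : (fun t => \sum_(i <- i :: r | P i) F i t) =
    fun t => F i t + \sum_(i <- r | P i) F i t.
  by apply/funext => u; rewrite big_cons Pi.
by move=> t; apply: continuousD; [exact: hF | exact: IH].
Qed.

Section KKT.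
Variables (R : realType) (d n : nat).
Variables (G : {set {set 'I_d}}) (c : 'I_n -> {set 'I_d} * 'I_d).
Variables (w : {set 'I_d} -> R) (lam rho : R) (b : 'cV[R]_d).
Hypothesis cG : forall k, (c k).1 \in G.
Hypotheses (lam0 : 0 < lam) (w0 : forall g, g \in G -> 0 < w g) (rho0 : 0 < rho).

Local Notation M := (Mmx R c).
Local Notation tau := (fun g => lam * w g).
Local Notation penalty := (penalty c G w lam).
Local Notation loss := (loss c b).
Local Notation objective := (objective c G w lam b).
Implicit Types x y z u v h : 'cV[R]_n.

Definition loss_grad x : 'cV[R]_n := M^T *m (M *m x - b).

Definition kkt y x :=
  y = loss_grad x /\ forall g, g \in G -> bsubgrad c g (tau g) y x.

Lemma tau_gt0 g : g \in G -> 0 < tau g.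
Proof. by move=> gG; rewrite mulr_gt0 // w0. Qed.

Lemma dotv_blocks u x : dotv u x = \sum_(g in G) bdot c g u x.
Proof. by rewrite /dotv (partition_big (fun k => (c k).1) (mem G)) //=. Qed.

Lemma penaltyE x : penalty x = \sum_(g in G) tau g * bnorm c g x.
Proof.
by rewrite /Defs.penalty mulr_sumr; apply: eq_bigr => g _; rewrite mulrA.
Qed.

Lemma penalty_ge0 x : 0 <= penalty x.
Proof.
rewrite penaltyE; apply: sumr_ge0 => g gG.
by rewrite mulr_ge0 ?bnorm_ge0 // ltW // tau_gt0.
Qed.

Lemma loss_ge0 x : 0 <= loss x.
Proof. by rewrite mulr_ge0 ?sqn_ge0 // invr_ge0. Qed.

Lemma lossD x h : loss (x + h) =
  loss x + dotv (loss_grad x) h + 2^-1 * sqn (M *m h).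
Proof.
rewrite /Defs.loss /loss_grad dotvC -dotv_mulmx mulmxDr addrAC.
move: (M *m x - b) (M *m h) => p q; rewrite !sqnE !dotvE (dotvC q p).
by field.
Qed.

Lemma loss_grad_mono x z : dotv (loss_grad x - loss_grad z) (x - z) =
  sqn (M *m x - M *m z).
Proof.
rewrite /loss_grad -mulmxBr dotvC -dotv_mulmx sqnE mulmxBr; congr dotv.
by rewrite opprB addrA subrK.
Qed.

(** The subgradient inequality of the penalty at [z1] and the gradient inequality of the convex loss
    at [z2] add up, and the terms in [x] cancel. *)
Lemma kkt_saddle y x z1 z2 : kkt y x ->
  objective x x <= objective z1 z2 + dotv y (z1 - z2).
Proof.
move=> [yx sx]; have : penalty x <= penalty z1 + dotv y (z1 - x).
  rewrite !penaltyE dotv_blocks -big_split /=; apply: ler_sum => g gG.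
  exact: bsubgrad_ineq (sx g gG).
have := lossD x (z2 - x); rewrite addrC subrK -yx.
have := sqn_ge0 (M *m (z2 - x)); rewrite /Defs.objective !dotvE; lra.
Qed.

(** The saddle inequality bounds the augmented Lagrangian at [y] below by the optimal value, while
    the feasible point [(x, x)] bounds every dual value above by it. *)
Lemma kkt_primal_dual_opt y x : kkt y x ->
  primal_dual_opt c G w lam rho b x x y.
Proof.
move=> hk; split.
  split=> // z _ <-; have := kkt_saddle z z hk.
  by rewrite subrr -(scale0r z) dotvZr mul0r addr0.
have zero z : dotv z (x - x) = 0 by rewrite subrr -(scale0r z) dotvZr mul0r.
have opt0 : 0 <= objective x x by rewrite addr_ge0 ?penalty_ge0 ?loss_ge0.
have sx0 : sqn (x - x) = 0 by apply/eqP; rewrite sqn_eq0 subrr.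
move=> z; apply: (@le_trans _ _ (objective x x)); last first.
  apply: lb_le_inf; first by eexists; exists (0, 0).
  move=> _ [[z1 z2] _ <-]; rewrite /aug_lag /=.
  apply: (le_trans (kkt_saddle z1 z2 hk)); rewrite lerDl mulr_ge0 ?sqn_ge0 //.
  by rewrite divr_ge0 // ltW.
rewrite /aug_dual; set E := (E in inf E).
(* [inf] of a set without lower bound is [0] *)
have [hE|hE] := pselect (has_inf E); last by rewrite inf_out.
apply: ge_inf; first by case: hE.
by exists (x, x) => //; rewrite /aug_lag /= zero sx0 mulr0 !addr0.
Qed.

(** A perturbation [h] supported on block [g] leaves the other block norms unchanged, so its
    first-order term is the subgradient inequality on [g] alone. *)
Lemma minimizer_kkt x : (forall z, objective x x <= objective z z) ->
  kkt (loss_grad x) x.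
Proof.
move=> hmin; split=> // g gG; apply: bsubgradP => [|z]; first exact/ltW/tau_gt0.
pose h : 'cV[R]_n := \col_k (if (c k).1 == g then (z - x) k 0 else 0).
rewrite -subr_ge0.
apply: (@ge0_of_small_quadratic _ _ (2^-1 * sqn (M *m h))) => s s0 s1.
have := hmin (x + s *: h); rewrite /Defs.objective lossD.
have yh : dotv (loss_grad x) h = bdot c g (loss_grad x) (z - x).
  rewrite /dotv (bigID (fun k => (c k).1 == g)) /= addrC big1 ?add0r.
    by apply: eq_bigr => k kg; rewrite [h _ _]mxE kg.
  by move=> k /negPf kg; rewrite [h _ _]mxE kg mulr0.
rewrite -scalemxAr [sqn (s *: _)]sqnE !dotvE yh -sqnE.
have pg : bnorm c g (x + s *: h) <= (1 - s) * bnorm c g x + s * bnorm c g z.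
  apply: le_trans (bnorm_convex _ _ _ _ (ltW s0) s1).
  rewrite /bnorm le_eqVlt; apply/orP; left; apply/eqP; congr (Num.sqrt _).
  by apply: eq_bigr => k kg; rewrite !mxE kg.
have po g' : g' != g -> bnorm c g' (x + s *: h) = bnorm c g' x.
  move=> /negPf g'g; congr (Num.sqrt _); apply: eq_bigr => k /eqP kg.
  by rewrite !mxE kg g'g mulr0 addr0.
rewrite !penaltyE !(bigD1 g gG) /=.
rewrite [X in _ <= _ + X + _](eq_bigr (fun g => lam * w g * bnorm c g x)); last first.
  by move=> g' /andP[_ g'g]; rewrite po.
have := ler_wpM2l (ltW (tau_gt0 gG)) pg; rewrite /= expr2.
by lra.
Qed.

Lemma kkt_exists : exists x, kkt (loss_grad x) x.
Proof.
suff [x hx] : exists x, forall z, objective x x <= objective z z.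
  by exists x; apply: minimizer_kkt.
(* Coercivity comes from the penalty: a coordinate larger than [r] makes the penalty of its own
   block at least [B0]. A minimizer over the box of radius [r] is therefore global. *)
pose B0 := objective 0 0; pose r := \sum_(g in G) B0 / tau g.
have B00 : 0 <= B0 by rewrite addr_ge0 ?penalty_ge0 ?loss_ge0.
have rg g : g \in G -> B0 / tau g <= r.
  move=> gG; rewrite /r (bigD1 g) //= lerDl; apply: sumr_ge0 => g' /andP[g'G _].
  by rewrite divr_ge0 // ltW // tau_gt0.
have r0 : 0 <= r.
  by apply: sumr_ge0 => g gG; rewrite divr_ge0 // ltW // tau_gt0.
pose box := [set v : 'rV[R]_n | forall i, `[- r, r]%classic (v ord0 i)]%classic.
have cbox : compact box.
  apply: (@rV_compact _ _ (fun=> `[- r, r]%classic)) => _.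
  exact: segment_compact.
pose f (v : 'rV[R]_n) := objective v^T v^T.
have sqr_cont (T : topologicalType) (h : T -> R) : continuous h ->
    continuous (fun t => h t ^+ 2).
  move=> hc t; rewrite /continuous_at; under eq_fun do rewrite expr2.
  by rewrite expr2; apply: cvgM; apply: hc.
have scale_cont (T : topologicalType) (a : R) (h : T -> R) : continuous h ->
    continuous (fun t => a * h t).
  by move=> hc t; apply: (cvgM (cvg_cst a) (hc t)).
have coordT k : continuous (fun v : 'rV[R]_n => v^T k 0).
  move=> v; rewrite /continuous_at mxE; under eq_fun do rewrite mxE.
  exact: coord_continuous.
have pc : continuous (fun v : 'rV[R]_n => penalty v^T).
  apply: (scale_cont _).
  apply: (@sum_continuous _ _ _ _ _
    (fun g (v : 'rV[R]_n) => w g * bnorm c g v^T)) => g _.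
  apply: (scale_cont _) => v.
  apply: (@continuous_comp _ _ _ (fun v : 'rV[R]_n => bsq c g v^T) Num.sqrt);
    last exact: sqrt_continuous.
  apply: (@sum_continuous _ _ _ _ _ (fun k (v : 'rV[R]_n) => v^T k 0 ^+ 2)) => k _.
  exact: sqr_cont.
have lc : continuous (fun v : 'rV[R]_n => loss v^T).
  apply: (scale_cont _).
  apply: (@sum_continuous _ _ _ _ _
    (fun i (v : 'rV[R]_n) => (M *m v^T - b) i 0 ^+ 2)) => i _.
  apply: (sqr_cont _).
  have -> : (fun v : 'rV[R]_n => (M *m v^T - b) i 0) =
      fun v : 'rV[R]_n => \sum_k M i k * v^T k 0 - b i 0.
    by apply/funext => v; rewrite mxE [(_ *m _) _ _]mxE [(- b) _ _]mxE.
  have Mc : continuous (fun v : 'rV[R]_n => \sum_k M i k * v^T k 0).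
    by apply: sum_continuous => k _; apply: (scale_cont _).
  by move=> v; apply: (cvgB (Mc v) (cvg_cst _)).
have fc : continuous f by move=> v; exact: (cvgD (pc v) (lc v)).
have box0 : box 0.
  by move=> i /=; rewrite mxE in_itv /= oppr_le0 r0.
have [|v vbox hv] := @EVT_min_rV R n f box _ cbox (continuous_subspaceT fc).
  by exists 0.
exists v^T => z; have [zbox|zbox] := pselect (box z^T).
  by have := hv z^T (mem_set zbox); rewrite /f trmxK.
have : f v <= B0 by have := hv 0 (mem_set box0); rewrite {2}/f trmx0.
move=> /le_trans; apply.
have [k hk] : exists k, r < `|z k 0|.
  apply: contrapT => /forallNP h; apply: zbox => k /=.
  rewrite mxE in_itv /= -ler_norml leNgt; exact/negP/h.
have kG := cG k.
apply: (@le_trans _ _ (tau (c k).1 * bnorm c (c k).1 z)).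
  have := rg _ kG; rewrite ler_pdivrMr ?tau_gt0 // mulrC => h; apply: (le_trans h).
  rewrite ler_pM2l ?tau_gt0 // (le_trans (ltW hk)) //.
  exact: coord_le_bnorm.
rewrite /Defs.objective penaltyE (bigD1 (c k).1) //= -addrA lerDl addr_ge0 ?loss_ge0 //.
apply: sumr_ge0 => g /andP[gG _].
by rewrite mulr_ge0 ?bnorm_ge0 // ltW // tau_gt0.
Qed.

End KKT.

(** * The polyhedron of solutions *)

Section Polyhedron.
Variables (R : realType) (d n : nat).
Variables (G : {set {set 'I_d}}) (c : 'I_n -> {set 'I_d} * 'I_d).
Variables (w : {set 'I_d} -> R) (lam : R) (b : 'cV[R]_d).
Hypothesis cG : forall k, (c k).1 \in G.
Hypotheses (lam0 : 0 < lam) (w0 : forall g, g \in G -> 0 < w g).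
Variables (ys x0 : 'cV[R]_n).
Hypothesis kkt0 : kkt G c w lam b ys x0.

Local Notation M := (Mmx R c).
Local Notation tau := (fun g => lam * w g).
Local Notation bs := (M *m x0).
Implicit Types x y z u v h : 'cV[R]_n.

(** The multiplier attains its bound on the block of [k]; only there can a solution be nonzero. *)
Definition active k := bnorm c (c k).1 ys == lam * w (c k).1.

Definition constr : finType :=
  ('I_d * bool + ('I_n * bool + ('I_n * 'I_n + 'I_n)))%type.

(** The four families: the image equations, with [s] giving both signs; vanishing on inactive
    blocks; parallelism to [ys] on active blocks, as 2 by 2 minors whose two orders give equality;
    and the sign of each coordinate relative to [ys]. Inapplicable indices give [0 <= 0]. *)
Definition constr_coef (j : constr) (i : 'I_n) : R := match j with
  | inl (p, s) => (-1) ^+ s * M p i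
  | inr (inl (k, s)) => if active k then 0 else (-1) ^+ s * (i == k)%:R
  | inr (inr (inl (k, l))) =>
      if active k && ((c l).1 == (c k).1)
      then ys l 0 * (i == k)%:R - ys k 0 * (i == l)%:R else 0
  | inr (inr (inr k)) => if active k then ys k 0 * (i == k)%:R else 0
  end.

Definition constr_rhs (j : constr) : R :=
  if j is inl (p, s) then (-1) ^+ s * bs p 0 else 0.

Definition constr_lhs j x : R := \sum_i constr_coef j i * x i 0.

(* The primal solutions, all of which share the multiplier [ys] and the image
   [bs]: on a block with [|ys| < tau] they vanish, and on a block with
   [|ys| = tau] they are nonpositive multiples of [ys]. *)
Definition sol x := forall j, constr_lhs j x <= constr_rhs j.

Lemma sum_delta k x : \sum_i (i == k)%:R * x i 0 = x k 0.
Proof.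
rewrite (bigD1 k) //= eqxx mul1r big1 ?addr0 // => i /negPf ->.
by rewrite mul0r.
Qed.

Lemma constr_lhsE j x : constr_lhs j x = match j with
  | inl (p, s) => (-1) ^+ s * (M *m x) p 0
  | inr (inl (k, s)) => if active k then 0 else (-1) ^+ s * x k 0
  | inr (inr (inl (k, l))) =>
      if active k && ((c l).1 == (c k).1)
      then ys l 0 * x k 0 - ys k 0 * x l 0 else 0
  | inr (inr (inr k)) => if active k then ys k 0 * x k 0 else 0
  end.
Proof.
have zero : \sum_(i < n) 0 * x i 0 = 0 by apply: big1 => i _; rewrite mul0r.
rewrite /constr_lhs; case: j => [[p s]|[[k s]|[[k l]|k]]] /=.
- by rewrite [in RHS]mxE mulr_sumr; apply: eq_bigr => i _; rewrite mulrA.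
- case: ifP => // _; rewrite -[in RHS](sum_delta k x) mulr_sumr.
  by apply: eq_bigr => i _; rewrite mulrA.
- case: ifP => // _; under eq_bigr do rewrite mulrBl -!mulrA.
  by rewrite sumrB -!mulr_sumr !sum_delta.
- case: ifP => // _; rewrite -[in RHS](sum_delta k x) mulr_sumr.
  by apply: eq_bigr => i _; rewrite mulrA.
Qed.

Lemma sol_image x : sol x -> M *m x = bs.
Proof.
move=> h; apply/colP => p.
have := h (inl (p, false)); have := h (inl (p, true)).
rewrite !constr_lhsE /= expr0 expr1 !mul1r !mulN1r; lra.
Qed.

Lemma sol_kkt x : sol x -> kkt G c w lam b ys x.
Proof.
move=> h; have [y0 s0] := kkt0; split.
  by rewrite y0 /loss_grad (sol_image h).
move=> g gG; have [yt _] := s0 g gG; split=> //.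
have [ya|ya] := eqVneq (bnorm c g ys) (lam * w g); last first.
  have x00 k : (c k).1 == g -> x k 0 = 0.
    move=> /eqP kg; have /negPf na : ~~ active k by rewrite /active kg.
    have := h (inr (inl (k, false))); have := h (inr (inl (k, true))).
    rewrite !constr_lhsE /= na expr0 expr1 mul1r mulN1r; lra.
  rewrite /bnorm /bsq /bdot !big1 ?sqrtr0 ?mulr0 ?oppr0 // => k kg.
    by rewrite x00 ?expr0n.
  by rewrite x00 ?mulr0.
have ak k : (c k).1 == g -> active k by move=> /eqP kg; rewrite /active kg ya.
have neg : bdot c g ys x <= 0.
  apply: sumr_le0 => k kg; have := h (inr (inr (inr k))).
  by rewrite constr_lhsE ak.
have cross k l : (c k).1 == g -> (c l).1 == g -> ys l 0 * x k 0 = ys k 0 * x l 0.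
  move=> kg lg.
  have := h (inr (inr (inl (k, l)))); have := h (inr (inr (inl (l, k)))).
  rewrite !constr_lhsE /= !ak // (eqP kg) (eqP lg) eqxx /=; lra.
(* Parallelism makes Cauchy-Schwarz an equality, and [neg] selects the sign of the square root. *)
rewrite -ya -sqrtrM ?bsq_ge0 // -[LHS]opprK; congr (- _).
rewrite -[LHS]ger0_norm ?oppr_ge0 // -sqrtr_sqr sqrrN; congr Num.sqrt.
rewrite expr2 /bdot /bsq !mulr_suml; apply: eq_bigr => k kg.
rewrite !mulr_sumr; apply: eq_bigr => l lg.
have := cross k l kg lg; rewrite !expr2 => e.
transitivity (ys k 0 * x l 0 * (ys l 0 * x k 0)); first by ring.
by rewrite e -e [in LHS]e; ring.
Qed.

Lemma sol_closed x :
  (forall e, 0 < e -> exists2 z, sol z & nrm (x - z) <= e) -> sol x.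
Proof.
move=> h j; apply/ler_addgt0Pr => e e0.
pose A := 1 + \sum_i `|constr_coef j i|.
have A0 : 0 < A by rewrite ltr_pwDl // sumr_ge0.
have [z hz xz] := h (e / A) (divr_gt0 e0 A0).
have -> : constr_lhs j x = constr_lhs j z + constr_lhs j (x - z).
  by rewrite -big_split; apply: eq_bigr => i _; rewrite /= !mxE; ring.
apply: lerD; first exact: hz.
apply: (le_trans (ler_norm _)); apply: (le_trans (ler_norm_sum _ _ _)).
apply: (@le_trans _ _ (A * (e / A))); last by rewrite mulrC divfK // gt_eqF.
rewrite /A mulrDl mul1r ler_wpDl //; first by rewrite divr_ge0 // ltW.
rewrite mulr_suml; apply: ler_sum => i _; rewrite normrM ler_wpM2l //.
exact: le_trans (coord_le_nrm _ _) xz.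
Qed.

(** Calmness of the subdifferential in linear form: exact relations between [x] and its own [u]
    become constraints up to an error when [u] is replaced by [ys]. *)
Lemma sol_residual (B : R) : 0 <= B -> exists2 K, 0 <= K & forall u x,
  (forall g, g \in G -> bsubgrad c g (tau g) u x) -> nrm x <= B ->
  forall j, constr_lhs j x <=
    constr_rhs j + (nrm (M *m x - bs) + K * nrm (u - ys)).
Proof.
move=> B0; have [_ s0] := kkt0.
have tau0 g : g \in G -> 0 < lam * w g by move=> gG; rewrite mulr_gt0 // w0.
have [gap gapE] : exists gap, forall g, gap g = lam * w g - bnorm c g ys.
  by exists (fun g => lam * w g - bnorm c g ys).
have gap0 g : g \in G -> 0 <= gap g.
  by move=> gG; rewrite gapE subr_ge0; have [] := s0 g gG.
(* [S] dominates the inverse of each positive gap; a zero gap contributes zero, the value of its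
   inverse. *)
pose S := \sum_(g in G) (gap g)^-1.
have S0 : 0 <= S by apply: sumr_ge0 => g gG; rewrite invr_ge0 gap0.
have gapS g : g \in G -> (gap g)^-1 <= S.
  move=> gG; rewrite /S (bigD1 g) //= lerDl; apply: sumr_ge0 => g' /andP[g'G _].
  by rewrite invr_ge0 gap0.
exists (B * S + 2 * B) => [|u x sx xB j]; first by rewrite addr_ge0 ?mulr_ge0.
have E0 := nrm_ge0 (u - ys); have F0 := nrm_ge0 (M *m x - bs).
set e := nrm (u - ys) in E0 *; set f := nrm (M *m x - bs) in F0 *.
have BS : 0 <= B * S * e by rewrite !mulr_ge0.
have Be : 0 <= B * e by rewrite mulr_ge0.
have RHS0 : 0 <= f + (B * S + 2 * B) * e by lra.
have uk k : `|u k 0 - ys k 0| <= e.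
  by have := coord_le_nrm (u - ys) k; rewrite !mxE.
have yk k : `|ys k 0| <= lam * w (c k).1.
  have [yt _] := s0 _ (cG k); apply: le_trans yt; exact: coord_le_bnorm.
have xk g : bnorm c g x <= B by apply: le_trans (bnorm_le_nrm _ _ _) xB.
have xc k : x k 0 = - (bnorm c (c k).1 x / (lam * w (c k).1) * u k 0).
  have := bsubgrad_coord (ltW (tau0 _ (cG k))) (sx _ (cG k)) (erefl _) => h.
  apply: (mulfI (lt0r_neq0 (tau0 _ (cG k)))); rewrite h mulrN mulrA; apply/esym.
  by rewrite [X in - (X * u k 0) = _]mulrC divfK // lt0r_neq0 // tau0.
have xt k : 0 <= bnorm c (c k).1 x / (lam * w (c k).1).
  by rewrite divr_ge0 ?bnorm_ge0 // ltW // tau0.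
have term k k' l : (c l).1 = (c k).1 -> (c k').1 = (c k).1 ->
    `|bnorm c (c k).1 x / (lam * w (c k).1) * ((u k' 0 - ys k' 0) * ys l 0)|
    <= B * e.
  move=> lk kk'; rewrite normrM (ger0_norm (xt k)) normrM.
  have := yk l; rewrite lk => yl.
  have := ler_pM (normr_ge0 _) (normr_ge0 _) (uk k') yl.
  move=> /(ler_wpM2l (xt k)) /le_trans; apply.
  rewrite mulrCA divfK; last exact/lt0r_neq0/tau0.
  by rewrite mulrC ler_wpM2r.
rewrite constr_lhsE; case: j => [[p s]|[[k s]|[[k l]|k]]] /=; rewrite ?add0r.
- rewrite -lerBlDl -mulrBr; apply: (@le_trans _ _ f); last by rewrite lerDl; lra.
  have := coord_le_nrm (M *m x - bs) p; rewrite -/f mxE [(- bs) p 0]mxE.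
  move=> h; apply: le_trans h; apply: le_trans (ler_norm _) _.
  by rewrite normrM normrX normrN1 expr1n mul1r.
(* On an inactive block slackness gives [gap * |x| <= |x| * e <= B * e]. *)
- case: ifP => [//|/negbT na]; apply: le_trans (ler_norm _) _.
  rewrite normrM normrX normrN1 expr1n mul1r.
  have gp : 0 < gap (c k).1.
    by rewrite lt_def gap0 // andbT gapE subr_eq0 eq_sym.
  apply: (@le_trans _ _ (B * S * e)); last by lra.
  apply: (le_trans (coord_le_bnorm _ (erefl _))).
  apply: (@le_trans _ _ (B * e * (gap (c k).1)^-1)); last first.
    by rewrite mulrAC ler_wpM2r // ler_wpM2l // gapS.
  rewrite ler_pdivlMr //.
  have /= h := bsubgrad_slack (sx _ (cG k)).
  have := bnormD c (c k).1 (u - ys) ys; rewrite subrK => h1.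
  have h2 := bnorm_le_nrm c (c k).1 (u - ys).
  have xp := bnorm_ge0 c (c k).1 x.
  have h3 : bnorm c (c k).1 u - bnorm c (c k).1 ys <= e by rewrite /e; lra.
  have h4 := ler_wpM2l xp h3; have h5 := ler_wpM2r E0 (xk (c k).1).
  rewrite gapE; lra.
(* With [x = - t u] on the block, the minor of [x] and [ys] equals that of [x + t ys] and [ys]: two
   terms, each at most [B * e]. *)
- case: ifP => // /andP[_ /eqP lk].
  have := term k k l lk (erefl _); have := term k l k (erefl _) lk.
  rewrite !ler_norml => /andP[h1 h2] /andP[h3 h4].
  have := xc l; rewrite lk => ->; rewrite (xc k).
  move: (bnorm c (c k).1 x / (lam * w (c k).1)) h1 h2 h3 h4 => t; lra.
(* Here [ys * x = - t * ys * (u - ys) - t * ys ^+ 2], and the last term has the right sign. *)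
- case: ifP => // _.
  have := term k k k (erefl _) (erefl _); rewrite ler_norml => /andP[h3 h4].
  have := mulr_ge0 (xt k) (sqr_ge0 (ys k 0)); rewrite (xc k) expr2.
  move: (bnorm c (c k).1 x / (lam * w (c k).1)) h3 h4 => t; lra.
Qed.

(** At [u = ys] and [x = x0] the residual bound is zero. *)
Lemma sol_x0 : sol x0.
Proof.
have [_ s0] := kkt0; have [K _ h] := sol_residual (nrm_ge0 x0).
move=> j; have := h ys x0 s0 (lexx _) j.
have nrm0 m : nrm (0 : 'cV[R]_m) = 0.
  by rewrite -(scale0r (0 : 'cV[R]_m)) nrmZ normr0 mul0r.
by rewrite !subrr !nrm0 mulr0 !addr0.
Qed.

(** Hoffman's bound with the residual of [sol_residual] as [eps]; the factor [n] passes from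
    coordinates to the Euclidean norm. *)
Lemma sol_error_bound (B : R) : 0 <= B -> exists2 K, 0 <= K & forall u x,
  (forall g, g \in G -> bsubgrad c g (tau g) u x) -> nrm x <= B ->
  exists2 z, sol z & nrm (x - z) <= K * (nrm (M *m x - bs) + nrm (u - ys)).
Proof.
move=> B0; have [K K0 hK] := sol_residual B0.
have [|H H0 hH] := @hoffman_bound R n constr constr_coef constr_rhs.
  by exists (fun i => x0 i 0); apply: sol_x0.
exists (n%:R * (H * (1 + K))) => [|u x sx xB].
  by rewrite !mulr_ge0 // addr_ge0.
set f := nrm (M *m x - bs); set e := nrm (u - ys).
have f0 : 0 <= f := nrm_ge0 _; have e0 : 0 <= e := nrm_ge0 _.
have [|z [hz xz]] := hH (fun i => x i 0) _ _ (hK u x sx xB).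
  by rewrite addr_ge0 // mulr_ge0.
exists (\col_i z i).
  move=> j; have := hz j; rewrite /constr_lhs.
  by under [X in _ -> X <= _]eq_bigr do rewrite mxE.
rewrite -!mulrA; apply: nrm_le_coord => i; rewrite !mxE.
apply: (le_trans (xz i)); rewrite ler_wpM2l //.
have := mulr_ge0 K0 f0; rewrite -/f -/e; lra.
Qed.

End Polyhedron.

(** * Linear convergence *)

Section Geometric.
Variable R : realType.

Lemma exists_geometric_le (C s e : R) : 0 <= C -> 0 < s -> s < 1 -> 0 < e ->
  exists k : nat, C * s ^+ k <= e.
Proof.
move=> C0 s0 s1 e0.
have e1 : 0 < e / (C + 1) by rewrite divr_gt0 // ltr_pwDr.
have : `|s| < 1 by rewrite gtr0_norm.
move/cvg_expr/cvgrPdist_lt/(_ _ e1) => [N _ /(_ N (leqnn N))] /=.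
rewrite sub0r normrN ger0_norm ?exprn_ge0 ?(ltW s0) // => h; exists N.
have := ltW h; rewrite ler_pdivlMr ?ltr_pwDr // => h'; apply: le_trans h'.
by rewrite mulrDr mulr1 mulrC lerDl exprn_ge0 // ltW.
Qed.

(** With [K = C / (1 - s)] the intervals of radius [K * s ^+ k] around [a k] are nested, because the
    radius shrinks by exactly [C * s ^+ k]. The supremum of their left ends lies in all of them. *)
Lemma geometric_limit (a : nat -> R) (C s : R) : 0 <= C -> 0 < s -> s < 1 ->
  (forall k, `|a k.+1 - a k| <= C * s ^+ k) ->
  exists l, forall k, `|a k - l| <= C / (1 - s) * s ^+ k.
Proof.
move=> C0 s0 s1 ha; have t0 : 0 < 1 - s by rewrite subr_gt0.
pose K := C / (1 - s); have KC : K * (1 - s) = C by rewrite divfK // gt_eqF.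
have K0 : 0 <= K by rewrite divr_ge0 // ltW.
pose L k := a k - K * s ^+ k; pose U k := a k + K * s ^+ k.
have step k : L k <= L k.+1 /\ U k.+1 <= U k.
  have := ha k; rewrite -KC ler_norml => /andP[h1 h2].
  by rewrite /L /U exprS; split; lra.
have Lmono k m : L k <= L (k + m)%N.
  elim: m => [|m IH]; rewrite ?addn0 // addnS (le_trans IH) //.
  by case: (step (k + m)%N).
have Umono k m : U (k + m)%N <= U k.
  elim: m => [|m IH]; rewrite ?addn0 // addnS (le_trans _ IH) //.
  by case: (step (k + m)%N).
have LU k m : L k <= U m.
  apply: (le_trans (Lmono k m)); apply: le_trans (Umono m k); rewrite addnC.
  have : 0 <= K * s ^+ (m + k) by rewrite mulr_ge0 // exprn_ge0 // ltW.
  by rewrite /L /U; lra.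
exists (sup (range L)) => k; rewrite ler_distlC; apply/andP; split.
  apply: ub_le_sup; last by exists k.
  by exists (U 0%N) => _ [m _ <-]; apply: LU.
apply: ge_sup; first by exists (L 0%N), 0%N.
by move=> _ [m _ <-]; apply: LU.
Qed.

Lemma nrm_geometric_limit m (x : nat -> 'cV[R]_m) (C s : R) :
  0 <= C -> 0 < s -> s < 1 ->
  (forall k, nrm (x k.+1 - x k) <= C * s ^+ k) ->
  exists l K, 0 <= K /\ forall k, nrm (x k - l) <= K * s ^+ k.
Proof.
move=> C0 s0 s1 hx.
have hi i : exists l, forall k, `|x k i 0 - l| <= C / (1 - s) * s ^+ k.
  apply: geometric_limit => // k; apply: le_trans (hx k).
  by have := coord_le_nrm (x k.+1 - x k) i; rewrite !mxE.
have [l hl] := fin_all_exists hi.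
exists (\col_i l i), (m%:R * (C / (1 - s))); split.
  by rewrite !mulr_ge0 // invr_ge0 subr_ge0 ltW.
by move=> k; rewrite -mulrA; apply: nrm_le_coord => i; rewrite !mxE.
Qed.

Lemma nrm_le_geometric m (x : 'cV[R]_m) (C s : R) k : 0 <= C -> 0 < s ->
  sqn x <= C * (s ^+ 2) ^+ k -> nrm x <= Num.sqrt C * s ^+ k.
Proof.
move=> C0 s0 h; apply: (@le_trans _ _ (Num.sqrt (C * (s ^+ 2) ^+ k))).
  by apply: ler_wsqrtr.
by rewrite sqrtrM // exprAC sqrtr_sqr ger0_norm // exprn_ge0 // ltW.
Qed.

Lemma le_of_sqr_le (m e a b : R) : 0 <= m -> 0 <= e -> 0 <= a -> 0 <= b ->
  m ^+ 2 <= a * e * m + b * e ^+ 2 -> m <= (a + b + 1) * e.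
Proof.
move=> m0 e0 a0 b0 h; have [me|em] := leP m e.
  by apply: (le_trans me); rewrite ler_peMl // lerDr addr_ge0.
have {}m0 : 0 < m by apply: le_lt_trans em.
suff : m <= (a + b) * e by lra.
rewrite -(ler_pM2r m0) -expr2; apply: (le_trans h).
have := ler_wpM2l (mulr_ge0 b0 e0) (ltW em); rewrite expr2; lra.
Qed.

End Geometric.

(** * One ADMM step: optimality, descent and error bound *)

Section Step.
Variables (R : realType) (d n : nat).
Variables (G : {set {set 'I_d}}) (c : 'I_n -> {set 'I_d} * 'I_d).
Variables (w : {set 'I_d} -> R) (lam rho : R) (b : 'cV[R]_d).
Hypothesis cG : forall k, (c k).1 \in G.
Hypotheses (lam0 : 0 < lam) (w0 : forall g, g \in G -> 0 < w g) (rho0 : 0 < rho).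

Local Notation M := (Mmx R c).
Local Notation tau := (fun g => lam * w g).
Local Notation grad := (loss_grad c b).
Implicit Types x y z u v h : 'cV[R]_n.

(** [D] is the gradient of the whole smooth objective; a step [- s *: D] changes the value by
    [- s |D|^2] to first order, so [D = 0]. *)
Lemma x2_step_grad x a p :
  (forall z, 2^-1 * sqn (M *m x - b) + rho / 2 * sqn (x - a - p)
          <= 2^-1 * sqn (M *m z - b) + rho / 2 * sqn (z - a - p)) ->
  grad x = rho *: (a + p - x).
Proof.
move=> h0; have h z : loss c b x + rho / 2 * sqn (x - a - p)
    <= loss c b z + rho / 2 * sqn (z - a - p) := h0 z.
apply/eqP; rewrite -subr_eq0 -sqn_eq0.
set D := grad x - _; rewrite eq_le sqn_ge0 andbT -oppr_ge0.
apply: (@ge0_of_small_quadratic _ _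
  (2^-1 * sqn (M *m D) + rho / 2 * sqn D)) => s s0 s1.
have := h (x + (- s) *: D); rewrite lossD -scalemxAr.
have -> : x + (- s) *: D - a - p = (x - a - p) + (- s) *: D.
  by rewrite [x + _]addrC -!addrA addrC !addrA.
have gD : grad x = D - rho *: (x - a - p).
  have -> : x - a - p = - (a + p - x) by rewrite opprB opprD addrA.
  by rewrite scalerN opprK subrK.
rewrite gD; clearbody D; move: (x - a - p) (M *m D) => q t.
by rewrite !sqnE !dotvE (dotvC D q) expr2; lra.
Qed.

(** The certificate of the [x1]-step involves the old [x2], the gradient of the [x2]-step the new
    one; the two differ by [rho] times the increment of [x2]. *)
Lemma admm_stepP alpha (x1 x2 y : nat -> 'cV[R]_n) k :
  admm_seq c G w lam rho b alpha x1 x2 y ->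
  [/\ forall g, g \in G ->
        bsubgrad c g (tau g) (y k + rho *: (x1 k.+1 - x2 k)) (x1 k.+1),
      grad (x2 k.+1) = y k + rho *: (x1 k.+1 - x2 k.+1)
    & y k.+1 = y k + alpha *: (x1 k.+1 - x2 k.+1)].
Proof.
move=> /(_ k) [h1 [h2 ->]]; have ry : rho *: (rho^-1 *: y k) = y k.
  by rewrite scalerA divff ?scale1r // gt_eqF.
split=> // [g gG|].
  apply: (@bprox_subgrad _ _ _ _ _ _ rho _ _ (- x2 k + rho^-1 *: y k)).
  - by rewrite mulr_ge0 ?ltW // w0.
  - by rewrite addrA [RHS]scalerDr ry; apply: addrC.
  - by move=> z; have := h1 g gG z; rewrite !addrA.
by rewrite (x2_step_grad h2) addrAC scalerDr ry; apply: addrC.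
Qed.

Section Solution.
Variables (ys x0 : 'cV[R]_n).
Hypothesis kkt0 : kkt G c w lam b ys x0.
Local Notation sol := (sol c w lam ys x0).

(** The weight [alpha^-1] makes the cross term of the dual update independent of the stepsize. *)
Definition lyap (alpha : R) x2 y z :=
  alpha^-1 * sqn (y - ys) + rho * sqn (x2 - z).

Lemma subgrad_mono u x z : sol z ->
  (forall g, g \in G -> bsubgrad c g (tau g) u x) ->
  dotv (u - ys) (x - z) <= 0.
Proof.
move=> /(sol_kkt kkt0) [_ sz] sx; rewrite (dotv_blocks cG).
by apply: sumr_le0 => g gG; apply: bsubgrad_mono (sx g gG) (sz g gG).
Qed.

Lemma grad_mono x z : sol z ->
  dotv (grad x - ys) (x - z) = sqn (M *m x - M *m x0).
Proof.
move=> sz; have [yz _] := sol_kkt kkt0 sz.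
by rewrite yz loss_grad_mono (sol_image sz).
Qed.

Lemma lyap_descent_dot (alpha : R) (eta r de p : 'cV[R]_n) :
  0 < alpha -> alpha <= rho / 2 ->
  dotv (eta + rho *: (r + de)) (p + r) <= 0 ->
  0 <= dotv (eta + rho *: r) p ->
  alpha^-1 * sqn (eta + alpha *: r) + rho * sqn p
    + rho / 8 * (sqn r + sqn de)
  <= alpha^-1 * sqn eta + rho * sqn (p - de).
Proof.
move=> a0 ar.
(* Subtracting the two hypotheses eliminates [dotv eta p]. Using [alpha <= rho / 2], it remains that
   [11/8 |r|^2 + 2 <r, de> + 7/8 |de|^2] is nonnegative; it is [1/56] of
   [|8 r + 7 de|^2 + 13 |r|^2]. *)
have h3 := mulr_ge0 (ltW rho0) (sqn_ge0 (8 *: r + 7 *: de)).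
have h4 := mulr_ge0 (ltW rho0) (sqn_ge0 r).
have h5 := ler_wpM2r (sqn_ge0 r) ar.
have -> : alpha^-1 * sqn (eta + alpha *: r) =
    alpha^-1 * sqn eta + 2 * dotv eta r + alpha * sqn r.
  by rewrite !sqnE !dotvE (dotvC r eta); field; rewrite gt_eqF.
move: h3 h4 h5; rewrite !sqnE !dotvE.
rewrite (dotvC de r) (dotvC r p) (dotvC de p).
by lra.
Qed.

Lemma lyap_descent (alpha : R) x1' x2' x2 y y' z :
  0 < alpha -> alpha <= rho / 2 ->
  (forall g, g \in G -> bsubgrad c g (tau g) (y + rho *: (x1' - x2)) x1') ->
  grad x2' = y + rho *: (x1' - x2') ->
  y' = y + alpha *: (x1' - x2') -> sol z ->
  lyap alpha x2' y' z + rho / 8 * (sqn (x1' - x2') + sqn (x2' - x2))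
    <= lyap alpha x2 y z.
Proof.
move=> a0 ar hu hv -> sz.
have := subgrad_mono sz hu; have := grad_mono x2' sz; rewrite hv => h2 h1.
have := @lyap_descent_dot alpha (y - ys) (x1' - x2') (x2' - x2) (x2' - z) a0 ar.
have -> : x1' - x2' + (x2' - x2) = x1' - x2 by rewrite addrA subrK.
have -> : x2' - z + (x1' - x2') = x1' - z by rewrite addrC addrA subrK.
have -> : x2' - z - (x2' - x2) = x2 - z.
  by rewrite opprB addrC addrA subrK.
rewrite !(addrAC y (- ys)) => /(_ h1); rewrite h2; apply; exact: sqn_ge0.
Qed.

Lemma step_error_bound (B : R) : 0 <= B -> exists2 K, 0 <= K &
  forall (alpha : R) x1' x2' x2 y y',
  0 < alpha -> alpha <= rho / 2 ->
  (forall g, g \in G -> bsubgrad c g (tau g) (y + rho *: (x1' - x2)) x1') ->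
  grad x2' = y + rho *: (x1' - x2') ->
  y' = y + alpha *: (x1' - x2') -> nrm x1' <= B ->
  exists2 z, sol z &
    nrm (x2' - z) <= K * (nrm (x1' - x2') + nrm (x2' - x2)) /\
    nrm (y' - ys) <= K * (nrm (x1' - x2') + nrm (x2' - x2)).
Proof.
move=> B0; have [K0 K00 hK] := sol_error_bound cG lam0 w0 kkt0 B0.
have [cM cM0 hM] := nrm_mulmx_le M; have [cT cT0 hT] := nrm_mulmx_le M^T.
have rge := ltW rho0.
(* The coefficients in [m ^+ 2 <= a * e * m + bq * e ^+ 2], proved below for the image error [m];
   [L] then bounds [m / e], and [K1] bounds the distance of [x1'] from [z]. *)
pose a := cT + rho * (K0 * (1 + cT)); pose bq := rho * (K0 * (cM + rho)).
have aa : 0 <= a by rewrite addr_ge0 // !mulr_ge0 // addr_ge0.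
have bb : 0 <= bq by rewrite !mulr_ge0 // addr_ge0.
pose L := a + bq + 1; have L0 : 0 <= L by apply: addr_ge0 => //; apply: addr_ge0.
pose K1 := K0 * ((1 + cT) * L + (cM + rho)).
have T1 : 0 <= 1 + cT by rewrite addr_ge0.
have K10 : 0 <= K1.
  by apply: mulr_ge0 => //; apply: addr_ge0; [exact: mulr_ge0 | exact: addr_ge0].
exists (K1 + 1 + (cT * L + rho)) => [|al x1' x2' x2 y y' al0 alr hu hv -> xB].
  by rewrite !addr_ge0 // ?mulr_ge0.
set r := x1' - x2' in hv *; set de := x2' - x2; set u := y + _ in hu.
set e := nrm r + nrm de; have r0 := nrm_ge0 r; have d0 := nrm_ge0 de.
have e0 : 0 <= e by rewrite addr_ge0.
have re : nrm r <= e by rewrite lerDl.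
have dee : nrm de <= e by rewrite lerDr.
set v := grad x2'; set m := nrm (M *m x2' - M *m x0).
have m0 : 0 <= m := nrm_ge0 _.
have vu : u = v + rho *: de.
  by rewrite /v hv /u -addrA -scalerDr /r /de addrA subrK.
have vm : nrm (v - ys) <= cT * m.
  have [-> _] := kkt0; rewrite /v /loss_grad -mulmxBr opprB addrA subrK; exact: hT.
have um : nrm (u - ys) <= cT * m + rho * e.
  rewrite vu addrAC; apply: (le_trans (nrmD _ _)); apply: lerD => //.
  by rewrite nrmZ ger0_norm // ler_wpM2l.
have xm : nrm (M *m x1' - M *m x0) <= m + cM * e.
  have -> : M *m x1' - M *m x0 = (M *m x2' - M *m x0) + M *m r.
    by rewrite /r mulmxBr [RHS]addrC addrA subrK.
  apply: (le_trans (nrmD _ _)); rewrite lerD2l; apply: (le_trans (hM r)).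
  by rewrite ler_wpM2l.
have [z sz xz] := hK u x1' hu xB.
have {}xz : nrm (x1' - z) <= K0 * ((1 + cT) * m + (cM + rho) * e).
  by apply: (le_trans xz); rewrite ler_wpM2l //; lra.
exists z => //.
have mL : m <= L * e.
  (* [m ^+ 2] is the product of [v - ys] with [(x1' - z) - r]. Monotonicity at [x1'] bounds the
     first part by [- rho <de, x1' - z>], and Cauchy-Schwarz does the rest. *)
  apply: le_of_sqr_le => //; rewrite sqr_nrm -(grad_mono x2' sz) -/v.
  have h1 := subgrad_mono sz hu.
  have -> : x2' - z = (x1' - z) - r by rewrite /r opprB [RHS]addrC addrA subrK.
  rewrite vu addrAC dotvDl dotvZl in h1.
  have h2 := dotv_le (v - ys) (- r); rewrite nrmN in h2.
  have h3 := ler_pM (nrm_ge0 _) r0 vm re.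
  have h4 := dotv_le (- de) (x1' - z); rewrite nrmN in h4.
  have h5 := ler_pM d0 (nrm_ge0 _) dee xz.
  have h6 := ler_wpM2l rge (le_trans h4 h5).
  rewrite dotvNl in h6; rewrite [leLHS]dotvDr /a /bq expr2; lra.
have x1z : nrm (x1' - z) <= K1 * e.
  have -> : K1 * e = K0 * ((1 + cT) * (L * e) + (cM + rho) * e).
    by rewrite /K1; ring.
  by apply: (le_trans xz); rewrite ler_wpM2l // lerD2r ler_wpM2l.
have vL : nrm (v - ys) <= cT * L * e.
  by apply: (le_trans vm); rewrite -mulrA ler_wpM2l.
have cLe : 0 <= cT * L * e by rewrite !mulr_ge0.
have K1e : 0 <= K1 * e by rewrite mulr_ge0.
have rhoe : 0 <= rho * e by rewrite mulr_ge0.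
split.
  have -> : x2' - z = (x1' - z) - r by rewrite /r opprB [RHS]addrC addrA subrK.
  by apply: (le_trans (nrmD _ _)); rewrite nrmN; lra.
have -> : y + al *: r - ys = (v - ys) + (al - rho) *: r.
  rewrite /v hv [RHS]addrAC -[y + rho *: r + _]addrA -scalerDl addrCA.
  by rewrite subrr addr0.
apply: (le_trans (nrmD _ _)); rewrite nrmZ ler0_norm; last by rewrite subr_le0; lra.
have : - (al - rho) * nrm r <= rho * e.
  by apply: ler_pM => //; lra.
by lra.
Qed.

Lemma admm_linear_convergence (alpha : R) (x1 x2 y : nat -> 'cV[R]_n) :
  0 < alpha -> alpha <= rho / 2 -> admm_seq c G w lam rho b alpha x1 x2 y ->
  exists2 xs, sol xs & exists C q : R, 0 <= C /\ 0 < q /\ q < 1 /\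
    forall k, dist3 (x1 k) (x2 k) (y k) xs xs ys <= C * q ^+ k.
Proof.
move=> a0 ar hadmm; have sx0 := sol_x0 cG lam0 w0 kkt0.
have ai : 0 < alpha^-1 by rewrite invr_gt0.
pose V k z := lyap alpha (x2 k) (y k) z.
pose E k := rho / 8 * (sqn (x1 k.+1 - x2 k.+1) + sqn (x2 k.+1 - x2 k)).
have E0 k : 0 <= E k by rewrite mulr_ge0 ?divr_ge0 ?addr_ge0 ?sqn_ge0 // ltW.
have V0 k z : 0 <= V k z by rewrite addr_ge0 // mulr_ge0 ?sqn_ge0 // ltW.
have desc k z : sol z -> V k.+1 z + E k <= V k z.
  by move=> sz; have [hu hv hy] := admm_stepP k hadmm; apply: lyap_descent.
pose W := V 0%N x0.
have VW k : V k x0 <= W.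
  by elim: k => [//|k IH]; have := desc k x0 sx0; have := E0 k; lra.
have [B B0 hB] : exists2 B, 0 <= B & forall k, nrm (x1 k.+1) <= B.
  (* The first root bounds the residual through [E k], the second bounds [x2 - x0] through [V]. *)
  exists (Num.sqrt (8 * W / rho) + Num.sqrt (W / rho) + nrm x0) => [|k].
    by rewrite !addr_ge0 ?sqrtr_ge0 ?nrm_ge0.
  have -> : x1 k.+1 = (x1 k.+1 - x2 k.+1) + (x2 k.+1 - x0) + x0.
    by rewrite addrA !subrK.
  apply: (le_trans (nrmD _ _)); rewrite lerD2r; apply: (le_trans (nrmD _ _)).
  have h := le_trans (desc k x0 sx0) (VW k).
  have p1 := mulr_ge0 (ltW rho0) (sqn_ge0 (x2 k.+1 - x2 k)).
  have p2 := mulr_ge0 (ltW ai) (sqn_ge0 (y k.+1 - ys)).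
  have p3 := mulr_ge0 (ltW rho0) (sqn_ge0 (x2 k.+1 - x0)).
  have p4 := mulr_ge0 (ltW rho0) (sqn_ge0 (x1 k.+1 - x2 k.+1)).
  rewrite /E /V /lyap in h.
  by apply: lerD; apply: ler_wsqrtr; rewrite ler_pdivlMr // mulrC; lra.
have [K K0 hK] := step_error_bound B0.
have near k : exists2 z, sol z &
    nrm (x2 k.+1 - z) <= K * (nrm (x1 k.+1 - x2 k.+1) + nrm (x2 k.+1 - x2 k)) /\
    nrm (y k.+1 - ys) <= K * (nrm (x1 k.+1 - x2 k.+1) + nrm (x2 k.+1 - x2 k)).
  have [hu hv hy] := admm_stepP k hadmm.
  exact: (hK _ _ _ _ _ _ a0 ar hu hv hy (hB k)).
(* Descent holds for each fixed [z], so it passes to the infimum, while the error bound may use a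
   different [z] at each step. *)
pose D k := inf [set V k z | z in sol]%classic.
have nonempty k : ([set V k z | z in sol] !=set0)%classic by exists (V k x0), x0.
have D_le k z : sol z -> D k <= V k z.
  move=> sz; apply: ge_inf; last by exists z.
  by exists 0 => _ [t _ <-].
have D_ge k t : (forall z, sol z -> t <= V k z) -> t <= D k.
  by move=> h; apply: lb_le_inf => // _ [z sz <-]; apply: h.
have D0 k : 0 <= D k by apply: D_ge.
have D_desc k : D k.+1 + E k <= D k.
  apply: D_ge => z sz; apply: le_trans (desc k z sz).
  by rewrite lerD2r D_le.
(* [16 / rho] converts [2 * (p ^+ 2 + q ^+ 2)] into [E k]; the final [1] makes [K'] positive. *)
pose K' := (alpha^-1 + rho) * K ^+ 2 * (16 / rho) + 1.
have K'1 : 0 < K'.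
  rewrite ltr_wpDl // !mulr_ge0 // ?invr_ge0 ?addr_ge0 ?sqr_ge0 ?(ltW rho0) //.
  exact: ltW.
have D_err k : D k.+1 <= K' * E k.
  have [z sz [hx hy]] := near k; apply: (le_trans (D_le k.+1 z sz)).
  rewrite /K' mulrDl mul1r ler_wpDr //.
  move: hx hy; rewrite /V /lyap /E.
  set p := nrm (x1 k.+1 - x2 k.+1); set q := nrm (x2 k.+1 - x2 k) => hx hy.
  have e2 : (K * (p + q)) ^+ 2 <= K ^+ 2 * (2 * (p ^+ 2 + q ^+ 2)).
    rewrite exprMn ler_wpM2l ?sqr_ge0 //.
    by have := sqr_ge0 (p - q); rewrite sqrrB sqrrD; lra.
  have sq m (h : 'cV[R]_m) t : nrm h <= t -> sqn h <= t ^+ 2.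
    by move=> ht; rewrite -sqr_nrm !expr2; apply: ler_pM; rewrite ?nrm_ge0.
  have := ler_wpM2l (ltW ai) (le_trans (sq _ _ _ hy) e2).
  have := ler_wpM2l (ltW rho0) (le_trans (sq _ _ _ hx) e2).
  rewrite -!sqr_nrm -/p -/q.
  have -> : (alpha^-1 + rho) * K ^+ 2 * (16 / rho) * (rho / 8 * (p ^+ 2 + q ^+ 2))
     = (alpha^-1 + rho) * (K ^+ 2 * (2 * (p ^+ 2 + q ^+ 2))).
    by field; rewrite !gt_eqF.
  by lra.
(* From [D k.+1 <= K' * E k <= K' * (D k - D k.+1)]. *)
pose q0 := K' / (K' + 1); have K'2 : 0 < K' + 1 by rewrite addr_gt0.
have q00 : 0 < q0 by rewrite divr_gt0.
have q01 : q0 < 1 by rewrite ltr_pdivrMr // mul1r ltrDl.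
have D_geo k : D k <= D 0%N * q0 ^+ k.
  elim: k => [|k IH]; first by rewrite expr0 mulr1.
  apply: (@le_trans _ _ (D k * q0)); last first.
    by rewrite exprSr [leRHS]mulrA ler_wpM2r // ltW.
  rewrite mulrA ler_pdivlMr //.
  have := ler_wpM2l (ltW K'1) (D_desc k); have := D_err k; lra.
(* [D] measures squared distances, so norms decay at the square root of its rate. *)
pose s := Num.sqrt q0.
have s0 : 0 < s by rewrite sqrtr_gt0.
have s2 : s ^+ 2 = q0 by rewrite sqr_sqrtr // ltW.
have s1 : s < 1 by rewrite -sqrtr1 ltr_sqrt.
rewrite -s2 in D_geo.
have C00 : 0 <= 8 * D 0%N / rho by rewrite divr_ge0 ?mulr_ge0 // ltW.
pose C1 := Num.sqrt (8 * D 0%N / rho); have C10 : 0 <= C1 := sqrtr_ge0 _.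
have E_geo k : E k <= D 0%N * (s ^+ 2) ^+ k.
  by apply: le_trans (D_geo k); have := D_desc k; have := D0 k.+1; lra.
have r_geo k : nrm (x1 k.+1 - x2 k.+1) <= C1 * s ^+ k.
  apply: nrm_le_geometric => //; rewrite mulrAC ler_pdivlMr // mulrC.
  have := mulr_ge0 (ltW rho0) (sqn_ge0 (x2 k.+1 - x2 k)).
  by have := E_geo k; rewrite /E; lra.
have d_geo k : nrm (x2 k.+1 - x2 k) <= C1 * s ^+ k.
  apply: nrm_le_geometric => //; rewrite mulrAC ler_pdivlMr // mulrC.
  have := mulr_ge0 (ltW rho0) (sqn_ge0 (x1 k.+1 - x2 k.+1)).
  by have := E_geo k; rewrite /E; lra.
pose C3 := Num.sqrt (alpha * D 0%N); have C30 : 0 <= C3 := sqrtr_ge0 _.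
have y_geo k : nrm (y k - ys) <= C3 * s ^+ k.
  apply: nrm_le_geometric => //; first by rewrite mulr_ge0 // ltW.
  rewrite -mulrA -ler_pdivrMl //; apply: le_trans (D_geo k).
  by apply: D_ge => z _; rewrite lerDl mulr_ge0 ?sqn_ge0 // ltW.
have [xs [C2 [C20 x_geo]]] := nrm_geometric_limit C10 s0 s1 d_geo.
exists xs.
  (* The solutions near [x2 k.+1] supplied by [near] approach [xs]. *)
  apply: sol_closed => e e0.
  have [|k hk] := @exists_geometric_le _ (C2 + K * (2 * C1)) _ _ _ s0 s1 e0.
    by rewrite addr_ge0 // !mulr_ge0.
  have [z sz [hz _]] := near k; exists z => //; apply: le_trans hk.
  have -> : xs - z = (xs - x2 k.+1) + (x2 k.+1 - z) by rewrite addrA subrK.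
  apply: (le_trans (nrmD _ _)); rewrite mulrDl; apply: lerD.
    rewrite nrmB; apply: (le_trans (x_geo _)); rewrite ler_wpM2l //.
    by rewrite exprS ler_piMl ?ltW // exprn_gt0.
  apply: (le_trans hz); rewrite -mulrA ler_wpM2l //.
  by have := r_geo k; have := d_geo k; lra.
pose C4 := nrm (x1 0%N - xs); have C40 : 0 <= C4 := nrm_ge0 _.
have C1s : 0 <= C1 / s by rewrite divr_ge0 // ltW.
(* [C4] covers the arbitrary initial [x1 0]; [C1 / s] absorbs the index shift, since the residual at
   [k.+1] is bounded by a multiple of [s ^+ k]. *)
exists (C4 + C1 / s + C2 + C2 + C3), s; do !split => //.
  by rewrite !addr_ge0.
move=> k; have sk : 0 <= s ^+ k by rewrite exprn_ge0 // ltW.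
have x1_geo : nrm (x1 k - xs) <= (C4 + C1 / s + C2) * s ^+ k.
  case: k sk => [|k] sk; first by rewrite expr0 mulr1 -addrA lerDl addr_ge0.
  have -> : x1 k.+1 - xs = (x1 k.+1 - x2 k.+1) + (x2 k.+1 - xs).
    by rewrite addrA subrK.
  apply: (le_trans (nrmD _ _)); rewrite mulrDl; apply: lerD => //.
  apply: (le_trans (r_geo k)); rewrite mulrDl ler_wpDl ?mulr_ge0 //.
  by rewrite exprS mulrA divfK // gt_eqF.
have := x_geo k; have := y_geo k.
have -> : dist3 (x1 k) (x2 k) (y k) xs xs ys = Num.sqrt
    (nrm (x1 k - xs) ^+ 2 + nrm (x2 k - xs) ^+ 2 + nrm (y k - ys) ^+ 2).
  by rewrite !sqr_nrm.
move: x1_geo (nrm_ge0 (x1 k - xs)) (nrm_ge0 (x2 k - xs)) (nrm_ge0 (y k - ys)).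
move: (nrm (x1 k - xs)) (nrm (x2 k - xs)) (nrm (y k - ys)) => p q t.
move=> hp p0 q_0 t0 ht hq.
apply: (@le_trans _ _ (p + q + t)); last by lra.
rewrite -[leRHS]ger0_norm ?addr_ge0 // -sqrtr_sqr; apply: ler_wsqrtr.
have := mulr_ge0 p0 q_0; have := mulr_ge0 p0 t0; have := mulr_ge0 q_0 t0.
by rewrite !expr2; lra.
Qed.

End Solution.
End Step.


Theorem theorem3p1 (R : realType) (d n : nat)
  (G : {set {set 'I_d}}) (c : 'I_n -> {set 'I_d} * 'I_d)
  (w : {set 'I_d} -> R) (lam rho : R) (b : 'cV[R]_d) :
  (forall g, g \in G -> g != set0) ->
  n = (\sum_(g in G) #|g|)%N ->
  injective c ->
  (forall k, (c k).1 \in G /\ (c k).2 \in (c k).1) ->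
  (forall g i, g \in G -> i \in g -> exists k, c k = (g, i)) ->
  0 < lam -> (forall g, g \in G -> 0 < w g) -> 0 < rho ->
  exists alpha0 : R, 0 < alpha0 /\
    forall alpha : R, 0 < alpha -> alpha <= alpha0 ->
    forall x1 x2 y : nat -> 'cV[R]_n,
      admm_seq c G w lam rho b alpha x1 x2 y ->
      exists x1s x2s ys : 'cV[R]_n,
        primal_dual_opt c G w lam rho b x1s x2s ys /\
        exists C q : R, 0 <= C /\ 0 < q /\ q < 1 /\
          forall k, dist3 (x1 k) (x2 k) (y k) x1s x2s ys <= C * q ^+ k.
Proof.
move=> _ _ _ hc _ lam0 w0 rho0; have cG k : (c k).1 \in G by case: (hc k).
(* The threshold of the Lyapunov descent, independent of the data [b], [w] and [lam]. *)
exists (rho / 2); split=> [|alpha a0 ar x1 x2 y hadmm]; first by rewrite divr_gt0.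
have [x0 kkt0] := kkt_exists b cG lam0 w0.
have [xs sxs conv] := admm_linear_convergence cG lam0 w0 rho0 kkt0 a0 ar hadmm.
exists xs, xs, (loss_grad c b x0); split=> //.
exact: (kkt_primal_dual_opt cG lam0 w0 rho0 (sol_kkt kkt0 sxs)).
Qed.
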